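(* Let $V=\{x_i\}_{i=1}^\infty\subset(0,\infty)$ with $0<x_1<x_2<\cdots<x_i<x_{i+1}<\cdots$, let $k_V(x_i,x_j)=\min(x_i,x_j)$ on $V\times V$, and let $\mathscr{H}_V$ be the reproducing kernel Hilbert space of $k_V$. Put $F_n=\{x_1,\dots,x_n\}$. Then $P_{F_n}(\delta_{x_1})=P_{F_2}(\delta_{x_1})$ for all $n\ge2$. Therefore $\delta_{x_1}\in\mathrm{span}\{k_{x_1}^{(V)},k_{x_2}^{(V)}\}$, and $$\delta_{x_1}=\zeta_{(2)}(x_1)\,k_{x_1}^{(V)}+\zeta_{(2)}(x_2)\,k_{x_2}^{(V)},\qquad \zeta_{(2)}(x_i)=\left(K_2^{-1}\delta_{x_1}\right)(x_i),\ i=1,2.$$ Specifically, $$\zeta_{(2)}(x_1)=\frac{x_2}{x_1(x_2-x_1)},\qquad \zeta_{(2)}(x_2)=\frac{-1}{x_2-x_1},\qquad \left\Vert\delta_{x_1}\right\Vert_{\mathscr{H}_V}^2=\frac{x_2}{x_1(x_2-x_1)}.$$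
   Context: $k_x^{(V)}=k_V(\cdot,x)$ as a function on $V$. $\mathscr{H}_V$ is the Hilbert space of functions on $V$ obtained by completing $\mathrm{span}\{k_x^{(V)}\}$ with $\langle k_x^{(V)},k_y^{(V)}\rangle=k_V(x,y)$. $\delta_{x_1}$ is the function on $V$ equal to $1$ at $x_1$ and $0$ elsewhere. $K_n=(\min(x_i,x_j))_{i,j=1}^n$, viewed as acting on functions on $F_n$. $P_{F_n}$ is the orthogonal projection of $\mathscr{H}_V$ onto $\mathrm{span}\{k_{x}^{(V)}:x\in F_n\}$, and $P_{F_n}(\delta_{x_1})=\sum_{y\in F_n}(K_n^{-1}\delta_{x_1})(y)\,k_y^{(V)}$ (this formula also makes sense before knowing $\delta_{x_1}\in\mathscr{H}_V$). *)

(* Defs.v *)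
From HB Require Import structures.
From mathcomp Require Export all_boot all_order all_algebra.
From mathcomp Require Export all_classical all_reals all_analysis.
Export Order.TTheory GRing.Theory Num.Theory.
Export numFieldNormedType.Exports.

Set Implicit Arguments.
Unset Strict Implicit.
Unset Printing Implicit Defensive.

Local Open Scope classical_set_scope.
Local Open Scope ring_scope.

Section RKHS.
Context {R : realType} {X : Type}.
Variable k : X -> X -> R.

Definition kfun (x : X) : X -> R := fun y => k y x.

(* A list of pairs (a_i, s_i) stands for the finite linear combination
   \sum_i a_i k_{s_i}; different lists may give the same function. *)
Definition comb (c : seq (R * X)) : X -> R :=
  fun y => \sum_(p <- c) p.1 * kfun p.2 y.

Definition comb_sub (c d : seq (R * X)) : seq (R * X) :=
  c ++ [seq (- q.1, q.2) | q <- d].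

(* the bilinear extension of <k_s, k_t> = k s t *)
Definition comb_ip (c d : seq (R * X)) : R :=
  \sum_(p <- c) \sum_(q <- d) p.1 * q.1 * k p.2 q.2.

Definition kspan (S : set X) : set (X -> R) :=
  [set f | exists (n : nat) (a : 'I_n -> R) (s : 'I_n -> X),
     (forall i, S (s i)) /\ f = (fun y => \sum_(i < n) a i * kfun (s i) y)].

Definition comb_cauchy (u : nat -> seq (R * X)) : Prop :=
  forall e : R, 0 < e -> exists N : nat, forall m n : nat,
    (N <= m)%N -> (N <= n)%N ->
    comb_ip (comb_sub (u m) (u n)) (comb_sub (u m) (u n)) < e.

(* The completion of the span of the k_x is realised inside X -> R: an
   abstract limit of a Cauchy sequence is identified with its pointwise limit,
   as forced by f(x) = <f, k_x>. *)
Definition approximates (u : nat -> seq (R * X)) (f : X -> R) : Prop :=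
  comb_cauchy u /\ forall y, comb (u n) y @[n --> \oo] --> f y.

Definition rkhs : set (X -> R) := [set f | exists u, approximates u f].

(* <f, g> is the limit of <u_n, v_n> for Cauchy sequences u, v representing
   f, g; for a positive semidefinite k this limit exists and does not depend
   on u and v. *)
Definition rkhs_ip (f g : X -> R) : R :=
  get [set r : R | exists u v, [/\ approximates u f, approximates v g
                                 & comb_ip (u n) (v n) @[n --> \oo] --> r]].

Definition rkhs_norm (f : X -> R) : R := Num.sqrt (rkhs_ip f f).

Definition orthogonal_projection_of (S : set (X -> R)) (f g : X -> R) : Prop :=
  S g /\ forall h, S h -> rkhs_ip (fun y => f y - g y) h = 0.

Section FinitePoints.
Variables (p : nat -> X) (n : nat).

Definition gram : 'M[R]_n := \matrix_(i, j) k (p i) (p j).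

(* (K_n^-1 f)(p i), where f is restricted to {p 0, ..., p n.-1} *)
Definition gram_coef (f : X -> R) (i : 'I_n) : R :=
  (invmx gram *m \col_j f (p j)) i 0.

Definition gram_proj (f : X -> R) : X -> R :=
  fun y => \sum_(i < n) gram_coef f i * kfun (p i) y.

End FinitePoints.
End RKHS.

Section MinKernel.
Context {R : realType}.
Variable x : nat -> R.

(* Points are numbered from 0: x i is the (i+1)-st point. The set V is range x,
   coerced to the type of its elements. *)
Definition pt (i : nat) : range x := exist _ (x i) (mem_set (imageT x i)).

Definition kV (s t : range x) : R := Num.min (val s) (val t).

Definition kx (i : nat) : range x -> R := kfun kV (pt i).

Definition Fn (n : nat) : set (range x) := pt @` `I_n.

Definition PF (n : nat) (f : range x -> R) : range x -> R :=
  gram_proj kV pt n f.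

Definition zeta (n : nat) (f : range x -> R) (i : 'I_n) : R :=
  gram_coef kV pt f i.

Definition delta (i : nat) : range x -> R := \1_[set pt i].

End MinKernel.

Arguments rkhs {R X} k.
Arguments rkhs_ip {R X} k f g.
Arguments rkhs_norm {R X} k f.
Arguments kspan {R X} k S.
Arguments orthogonal_projection_of {R X} k S f g.
Arguments pt {R} x i.
Arguments kV {R} x s t.
Arguments kx {R} x i y.
Arguments Fn {R} x n.
Arguments PF {R} x n f y.
Arguments zeta {R} x n f i.
Arguments delta {R} x i y.

(* Main.v *)
Require Import Defs.
From mathcomp Require Import ring lra.
Local Open Scope classical_set_scope.
Local Open Scope ring_scope.

(** Evaluating at the points [x i] shows that [delta x 0] is the combination
[z1 k_{x 0} + z2 k_{x 1}]: its value at [x 0] is [(z1 + z2) * x 0 = 1], and at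
every [x i] with [i >= 1] it is [z1 * x 0 + z2 * x 1 = 0] (lemma [delta0E]).  Since the Gram matrices [K_n] are
invertible, the coefficients of [K_n^-1 delta] are therefore [z1, z2, 0, ...]
for all [n >= 2], so that every [PF x n delta] is [delta] itself, and the
reproducing property gives [<delta, delta> = z1 * delta (x 0) = z1].

Both the invertibility of [K_n] and the positivity of the kernel come from
writing [min (x i) (x j)] as the sum of the gaps [x l - x (l - 1)] with [l <= i]
and [l <= j] (lemma [x_minn_sum]).

The analytic point is that the inner product of the completion, a limit along
arbitrary Cauchy sequences that converge pointwise to the given functions, is
on finite combinations the bilinear extension of the kernel (lemma
[rkhs_ip_comb]).  It rests on the fact that a Cauchy sequence of combinations
tending pointwise to a combination also tends to it in norm (lemma
[approximates_comb_norm]). *)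

(** * The inner product of the completion on finite combinations *)

Section InnerProduct.
Context {R : realType} {X : Type}.
Variable k : X -> X -> R.
Implicit Types (c d e : seq (R * X)) (u v : nat -> seq (R * X)).

(** The reproducing property on finite combinations. *)
Lemma comb_ipE c d : comb_ip k c d = \sum_(p <- c) p.1 * comb k d p.2.
Proof.
apply: eq_bigr => p _; rewrite /comb mulr_sumr.
by apply: eq_bigr => q _; rewrite /kfun mulrA.
Qed.

Lemma comb_ip_nill c : comb_ip k [::] c = 0.
Proof. by rewrite comb_ipE big_nil. Qed.

Lemma comb_subE c d y : comb k (comb_sub c d) y = comb k c y - comb k d y.
Proof.
rewrite /comb /comb_sub big_cat big_map /= -sumrN; congr (_ + _).
by apply: eq_bigr => q _; rewrite mulNr.
Qed.

Lemma comb_ip_subr c d e :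
  comb_ip k c (comb_sub d e) = comb_ip k c d - comb_ip k c e.
Proof.
rewrite !comb_ipE -sumrB; apply: eq_bigr => p _.
by rewrite comb_subE mulrBr.
Qed.

(** By the reproducing property, pointwise convergence implies weak convergence
against finite combinations; the limit function need not be a combination. *)
Lemma comb_ip_cvgr c u (f : X -> R) :
  (forall y, comb k (u n) y @[n --> \oo] --> f y) ->
  comb_ip k c (u n) @[n --> \oo] --> \sum_(p <- c) p.1 * f p.2.
Proof.
move=> uf; under eq_fun do rewrite comb_ipE.
elim: c => [|p c IH].
  by rewrite big_nil; under eq_fun do rewrite big_nil; exact: cvg_cst.
rewrite big_cons.
have -> : (fun n => \sum_(q <- p :: c) q.1 * comb k (u n) q.2) = (fun n =>
    p.1 * comb k (u n) p.2 + \sum_(q <- c) q.1 * comb k (u n) q.2).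
  by apply/funext => n; rewrite big_cons.
apply: cvgD IH; apply: cvgM; [exact: cvg_cst|exact: uf].
Qed.

Hypothesis k_sym : forall s t, k s t = k t s.

Lemma comb_ipC c d : comb_ip k c d = comb_ip k d c.
Proof.
rewrite /comb_ip exchange_big /=; apply: eq_bigr => p _.
by apply: eq_bigr => q _; rewrite k_sym [q.1 * _]mulrC.
Qed.

Lemma comb_ip_subl c d e :
  comb_ip k (comb_sub c d) e = comb_ip k c e - comb_ip k d e.
Proof. by rewrite comb_ipC comb_ip_subr !(comb_ipC e). Qed.

Hypothesis k_psd : forall c, 0 <= comb_ip k c c.

Lemma approximates_comb c : approximates k (fun=> c) (comb k c).
Proof.
split=> [e e0|y]; last exact: cvg_cst.
by exists 0%N => m n _ _; rewrite comb_ip_subr subrr.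
Qed.

(** The Cauchy-Schwarz inequality, weakened to avoid square roots. *)
Lemma comb_ip_le c d :
  `|comb_ip k c d| <= (comb_ip k c c + comb_ip k d d) / 2.
Proof.
have := k_psd (comb_sub c d).
have := k_psd (comb_sub c (comb_sub [::] d)).
rewrite !(comb_ip_subl, comb_ip_subr) (comb_ipC d c).
rewrite !comb_ip_nill !(comb_ipC _ [::]) !comb_ip_nill.
by rewrite ler_norml => h1 h2; apply/andP; split; lra.
Qed.

(** A Cauchy sequence of combinations that approximates a combination pointwise
also approximates it in norm.  If [w] is the difference, then for
large [N] and [m >= N] one has
[|w m|^2 <= |w m - w N|^2 + 2 <w N, w m>], in which the first term is
small uniformly in [m] and the second tends to 0 with [N] fixed. *)
Lemma approximates_comb_norm c u : approximates k u (comb k c) ->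
  comb_ip k (comb_sub (u n) c) (comb_sub (u n) c) @[n --> \oo] --> (0 : R).
Proof.
move=> [uC uc]; apply/cvgrPdist_lt => e e0.
have e2 : 0 < e / 2 by rewrite divr_gt0.
have [N uN] := uC _ e2.
have e4 : 0 < e / 4 by rewrite divr_gt0.
have w0 y : comb k (comb_sub (u n) c) y @[n --> \oo] --> (0 : R).
  rewrite -(subrr (comb k c y)); under eq_fun do rewrite comb_subE.
  by apply: cvgB; [exact: uc|exact: cvg_cst].
have /cvgrPdist_lt/(_ _ e4) wN :=
  @comb_ip_cvgr (comb_sub (u N) c) _ (fun=> 0) w0.
near=> m.
have Nm : (N <= m)%N by near: m; exact: nbhs_infty_ge.
have mN := uN m N Nm (leqnn N).
have : `|\sum_(p <- comb_sub (u N) c) p.1 * 0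
    - comb_ip k (comb_sub (u N) c) (comb_sub (u m) c)| < e / 4.
  by near: m; exact: wN.
rewrite big1; last by move=> p _; rewrite mulr0.
rewrite !sub0r !normrN ltr_norml => /andP[_].
have := k_psd (comb_sub (u N) c).
rewrite ger0_norm//.
move: mN; rewrite !(comb_ip_subl, comb_ip_subr).
rewrite (comb_ipC (u m) (u N)) (comb_ipC (u m) c) (comb_ipC (u N) c).
lra.
Unshelve. all: by end_near. Qed.

(** On the span of the kernel functions the inner product of the completion is
the bilinear extension of the kernel; in particular it does not depend on the
chosen representing sequences, nor on the chosen combinations. *)
Lemma rkhs_ip_comb c d : rkhs_ip k (comb k c) (comb k d) = comb_ip k c d.
Proof.
rewrite /rkhs_ip; set S := [set r | _].
have : S (get S).
  apply: (@getI _ _ (comb_ip k c d)); exists (fun=> c), (fun=> d).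
  by split; [exact: approximates_comb|exact: approximates_comb|exact: cvg_cst].
move=> [u [v [uc vd uv]]]; apply: (cvg_unique _ uv) => //.
have uc0 := approximates_comb_norm _ _ uc.
have vd0 := approximates_comb_norm _ _ vd.
have ud : comb_ip k d (u n) @[n --> \oo] --> comb_ip k c d.
  by rewrite comb_ipC comb_ipE; apply: comb_ip_cvgr; case: uc.
have cv : comb_ip k c (v n) @[n --> \oo] --> comb_ip k c d.
  by rewrite comb_ipE; apply: comb_ip_cvgr; case: vd.
(* The errors tend to 0 in norm, hence so does their inner product. *)
have rest : comb_ip k (comb_sub (u n) c) (comb_sub (v n) d)
    @[n --> \oo] --> (0 : R).
  apply/norm_cvg0P.
  apply: (@squeeze_cvgr _ _ _ _ (fun=> 0) (fun n =>
    (comb_ip k (comb_sub (u n) c) (comb_sub (u n) c)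
     + comb_ip k (comb_sub (v n) d) (comb_sub (v n) d)) / 2)).
  - by apply: nearW => n /=; rewrite normr_ge0 comb_ip_le.
  - exact: cvg_cst.
  - rewrite (_ : (0 : R) = (0 + 0) / 2); last by ring.
    by apply: cvgM; [exact: cvgD|exact: cvg_cst].
rewrite (_ : comb_ip k c d =
  0 + comb_ip k c d + comb_ip k c d - comb_ip k c d); last by ring.
have -> : (fun n => comb_ip k (u n) (v n)) = (fun n =>
    comb_ip k (comb_sub (u n) c) (comb_sub (v n) d)
    + comb_ip k d (u n) + comb_ip k c (v n) - comb_ip k c d).
  apply/funext => n; rewrite !(comb_ip_subl, comb_ip_subr) (comb_ipC d (u n)).
  by ring.
by apply: cvgB; [apply: cvgD; [exact: cvgD|]|exact: cvg_cst].
Qed.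

Lemma kspanP S h : kspan k S h -> exists c, h = comb k c.
Proof.
move=> [n [a [s [_ ->]]]]; exists [seq (a i, s i) | i <- enum 'I_n].
by apply/funext => y; rewrite /comb big_map big_enum.
Qed.

(** A function of [kspan k S] is its own projection: the inner product of the
zero function with any combination vanishes. *)
Lemma orthogonal_projection_of_id S f :
  kspan k S f -> orthogonal_projection_of k (kspan k S) f f.
Proof.
move=> Sf; split=> // h /kspanP[c ->].
have -> : (fun y => f y - f y) = comb k [::].
  by apply/funext => y; rewrite subrr /comb big_nil.
by rewrite rkhs_ip_comb comb_ip_nill.
Qed.

End InnerProduct.

(** * The kernel min on an increasing sequence of points *)

Section MinKernelFacts.
Context {R : realType}.
Variable x : nat -> R.
Hypothesis x_gt0 : 0 < x 0%N.
Hypothesis x_incr : forall i : nat, x i < x i.+1.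

Lemma x_le i j : (x i <= x j) = (i <= j)%N.
Proof. exact: (Order.NatMonotonyTheory.incnP x_incr). Qed.

Lemma min_x i j : Num.min (x i) (x j) = x (minn i j).
Proof. by rewrite minEle x_le /minn; case: ltngtP => // ->. Qed.

Lemma kV_pt i j : kV x (pt x i) (pt x j) = x (minn i j).
Proof. by rewrite /kV /= min_x. Qed.

Lemma pt_surj (s : range x) : exists i, s = pt x i.
Proof.
case: s => r rx; have [i _ xi] := set_mem rx.
by exists i; apply: val_inj.
Qed.

Lemma kV_sym s t : kV x s t = kV x t s.
Proof. by rewrite /kV minC. Qed.

(** The distance from [x l] to the preceding point, where the point preceding
[x 0] is the origin. *)
Definition gap (l : nat) : R := if l is l'.+1 then x l - x l' else x 0%N.

Lemma gap_gt0 l : 0 < gap l.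
Proof. by case: l => //= l; rewrite subr_gt0. Qed.

Lemma sum_gap m : \sum_(l < m.+1) gap l = x m.
Proof.
elim: m => [|m IH]; first by rewrite big_ord1.
by rewrite big_ord_recr /= IH addrC subrK.
Qed.

(** The factorization of the kernel: [min (x i) (x j)] is the total length of
the gaps below both points. *)
Lemma x_minn_sum n i j : (i < n)%N ->
  x (minn i j) = \sum_(l < n) (l <= i)%:R * gap l * (l <= j)%:R.
Proof.
move=> ltin; rewrite -sum_gap.
rewrite (big_ord_widen n gap); last by rewrite (leq_ltn_trans (geq_minl _ _)).
rewrite big_mkcond /=; apply: eq_bigr => l _.
rewrite ltnS leq_min; case: (l <= i)%N; case: (l <= j)%N;
  by rewrite ?mul0r ?mulr0 ?mul1r ?mulr1.
Qed.

(** By the factorization, the quadratic form is a sum of squares weighted by the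
gaps. *)
Lemma kV_psd c : 0 <= comb_ip (kV x) c c.
Proof.
have [idx idxE] := choice pt_surj.
pose n := (\max_(p <- c) (idx p.2)).+1.
have -> : comb_ip (kV x) c c =
    \sum_(l < n) gap l * (\sum_(p <- c) p.1 * (l <= idx p.2)%:R) ^+ 2.
  transitivity (\sum_(p <- c) \sum_(q <- c) \sum_(l < n)
      gap l * ((p.1 * (l <= idx p.2)%:R) * (q.1 * (l <= idx q.2)%:R))).
    rewrite /comb_ip !big_seq; apply: eq_bigr => p pc; apply: eq_bigr => q _.
    rewrite {1}(idxE p.2) {1}(idxE q.2) kV_pt (@x_minn_sum n); last first.
      by rewrite ltnS (@leq_bigmax_seq _ _ xpredT (fun q => idx q.2)).
    by rewrite mulr_sumr; apply: eq_bigr => l _; ring.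
  under eq_bigr do rewrite exchange_big.
  rewrite exchange_big; apply: eq_bigr => l _.
  rewrite expr2 mulr_suml mulr_sumr; apply: eq_bigr => p _.
  by rewrite !mulr_sumr.
by apply: sumr_ge0 => l _; rewrite mulr_ge0 ?sqr_ge0// ltW ?gap_gt0.
Qed.

(** [K_n = L D L^T] with [L] unitriangular and [D] the diagonal matrix of the
gaps. *)
Lemma gram_unit n : gram (kV x) (pt x) n \in unitmx.
Proof.
pose L : 'M[R]_n := \matrix_(i, l) (l <= i)%:R.
pose D : 'rV[R]_n := \row_l gap l.
have -> : gram (kV x) (pt x) n = L *m diag_mx D *m L^T.
  apply/matrixP => i j; rewrite !mxE kV_pt (x_minn_sum _ _ _ (ltn_ord i)).
  apply: eq_bigr => l _; rewrite mul_mx_diag !mxE; ring.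
have Lu : L \in unitmx.
  rewrite unitmxE det_trig; last first.
    by apply/is_trig_mxP => i j ij; rewrite mxE leqNgt ij.
  by rewrite big1 ?unitr1// => i _; rewrite mxE leqnn.
rewrite !unitmx_mul unitmx_tr Lu andbT /= unitmxE det_diag unitfE.
by apply/prodf_neq0 => l _; rewrite mxE gt_eqF ?gap_gt0.
Qed.

(** * The point mass at the first point *)

Lemma delta0_pt i : delta x 0%N (pt x i) = (i == 0%N)%:R.
Proof.
rewrite /delta indicE; congr ((_ : bool)%:R).
apply/idP/eqP => [|->]; last by rewrite inE.
rewrite inE /= => /(congr1 val) /= xi.
by apply/eqP; rewrite -leqn0 -x_le xi.
Qed.

(** The coefficient of the point mass at [x 0] on the kernel function of [x 0]. *)
Definition z1 : R := x 1%N / (x 0%N * (x 1%N - x 0%N)).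

(** Its coefficient on the kernel function of [x 1]. *)
Definition z2 : R := - 1 / (x 1%N - x 0%N).

(** Only the values [min (x i) (x 0) = x 0] and, for [i >= 1],
[min (x i) (x 1) = x 1] enter, which is why two kernel functions suffice. *)
Lemma delta0E : delta x 0%N = (fun y => z1 * kx x 0%N y + z2 * kx x 1%N y).
Proof.
apply/funext => y; have [i ->] := pt_surj y.
rewrite delta0_pt /kx /kfun !kV_pt minn0 /z1 /z2.
have x0 : x 0%N != 0 by rewrite gt_eqF.
have x10 : x 1%N - x 0%N != 0 by rewrite gt_eqF// subr_gt0.
case: i => [|i]; rewrite ?min0n /= ?(minn_idPr _)//;
  by field; rewrite x10 x0.
Qed.

(** The solution of [K_n z = delta], for every [n >= 2]. *)
Definition zcoef (i : nat) : R :=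
  if i == 0%N then z1 else if i == 1%N then z2 else 0.

Lemma sum_zcoef n (F : nat -> R) : (2 <= n)%N ->
  \sum_(i < n) zcoef i * F i = z1 * F 0%N + z2 * F 1%N.
Proof.
case: n => [|[|n]]// _; rewrite !big_ord_recl big1 ?addr0// => i _.
by rewrite /zcoef /= mul0r.
Qed.

Lemma zeta_delta0 n (i : 'I_n) : (2 <= n)%N ->
  zeta x n (delta x 0%N) i = zcoef i.
Proof.
move=> n2; rewrite /zeta /gram_coef.
have -> : \col_(j < n) delta x 0%N (pt x j) =
    gram (kV x) (pt x) n *m \col_(j < n) zcoef j.
  apply/matrixP => j o; rewrite !mxE {1}delta0E.
  rewrite -(@sum_zcoef n (fun i => kx x i (pt x j)))//.
  by apply: eq_bigr => l _; rewrite !mxE mulrC.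
by rewrite mulKmx ?gram_unit// mxE.
Qed.

Lemma PF_delta0 n : (2 <= n)%N -> PF x n (delta x 0%N) = delta x 0%N.
Proof.
move=> n2; rewrite {2}delta0E; apply/funext => y.
rewrite -(@sum_zcoef n (fun i => kx x i y))//.
by apply: eq_bigr => i _; rewrite -/(zeta x n _ i) zeta_delta0.
Qed.

Lemma kspan_delta0 (S : set (range x)) : S (pt x 0%N) -> S (pt x 1%N) ->
  kspan (kV x) S (delta x 0%N).
Proof.
move=> S0 S1; exists 2%N, (fun i => zcoef i), (fun i => pt x i); split.
  by case=> [[|[|]]].
by rewrite delta0E; apply/funext => y; rewrite (@sum_zcoef 2 (kx x ^~ y)).
Qed.

Lemma delta0_comb :
  delta x 0%N = comb (kV x) [:: (z1, pt x 0%N); (z2, pt x 1%N)].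
Proof.
by rewrite delta0E; apply/funext => y; rewrite /comb !big_cons big_nil addr0.
Qed.

Lemma rkhs_ip_delta0 : rkhs_ip (kV x) (delta x 0%N) (delta x 0%N) = z1.
Proof.
rewrite {1 2}delta0_comb rkhs_ip_comb; [|exact: kV_sym|exact: kV_psd].
rewrite comb_ipE -delta0_comb !big_cons big_nil /= !delta0_pt /=.
by rewrite mulr1 mulr0 !addr0.
Qed.

End MinKernelFacts.

Theorem corollary3p5 (R : realType) (x : nat -> R)
    (x_gt0 : 0 < x 0%N) (x_incr : forall i : nat, x i < x i.+1) :
  let d := delta x 0%N in
  let zeta1 := zeta x 2%N d ord0 in
  let zeta2 := zeta x 2%N d ord_max in
  [/\ forall n : nat, (2 <= n)%N ->
        PF x n d = PF x 2%N d
        /\ orthogonal_projection_of (kV x) (kspan (kV x) (Fn x n)) d (PF x n d),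
      rkhs (kV x) d /\ kspan (kV x) [set pt x 0%N; pt x 1%N] d,
      d = (fun y => zeta1 * kx x 0%N y + zeta2 * kx x 1%N y),
      zeta1 = x 1%N / (x 0%N * (x 1%N - x 0%N))
      /\ zeta2 = - 1 / (x 1%N - x 0%N) &
      rkhs_norm (kV x) d ^+ 2 = x 1%N / (x 0%N * (x 1%N - x 0%N))].
Proof.
move=> d zeta1 zeta2.
have z1E : zeta1 = z1 x by rewrite /zeta1 zeta_delta0.
have z2E : zeta2 = z2 x by rewrite /zeta2 zeta_delta0.
split.
- move=> n n2; rewrite !PF_delta0//; split=> //.
  apply: orthogonal_projection_of_id; [exact: kV_sym|exact: kV_psd|].
  apply: kspan_delta0 => //; first by exists 0%N => //=; exact: ltnW.
  by exists 1%N.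
- split; last by apply: kspan_delta0 => //; [left|right].
  rewrite /d delta0_comb//; eexists; apply: approximates_comb.
- by rewrite z1E z2E /d delta0E.
- by rewrite z1E z2E.
- rewrite /rkhs_norm rkhs_ip_delta0// sqr_sqrtr//.
  by rewrite divr_ge0 ?mulr_ge0 ?subr_ge0 ?ltW// (lt_trans x_gt0).
Qed.
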